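(* There is an absolute constant $C>0$ such that for every integer $r\geq 2$ and every bipartite graph $F$, we have $$f_{F,K_r}(n)=O\left(n^{\frac{C}{\log r}}\right)$$ as $n\to\infty$.
   Context: All graphs are finite and simple. A graph is $F$-free if it does not contain $F$ as a (not necessarily induced) subgraph. For graphs $F,H$ and a positive integer $n$, $f_{F,H}(n)$ denotes the largest $m$ such that every $H$-free graph on $n$ vertices contains an $F$-free induced subgraph on $m$ vertices. $K_r$ is the complete graph on $r$ vertices. The constant $C$ does not depend on $r$, $F$ or $n$; the constant implied by $O(\cdot)$ may depend on $r$ and $F$ but not on $n$. Logarithms are in base $2$. *)

(* Defs.v *)
From HB Require Import structures.
From mathcomp Require Import all_boot all_order all_algebra.
From mathcomp Require Import all_classical all_reals all_analysis.

Set Implicit Arguments.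
Unset Strict Implicit.
Unset Printing Implicit Defensive.

Import Order.TTheory GRing.Theory Num.Theory.

Local Open Scope ring_scope.

Record sgraph := SGraph {
  vertex :> finType;
  edge : rel vertex;
  edge_sym : symmetric edge;
  edge_irrefl : irreflexive edge }.

(* F is a not necessarily induced subgraph of G. *)
Definition contains (F G : sgraph) : Prop :=
  exists2 f : F -> G, injective f & forall x y, edge x y -> edge (f x) (f y).

(* G is F-free. *)
Definition free (F G : sgraph) : Prop := ~ contains F G.

Definition bipartite (F : sgraph) : Prop :=
  exists A : {set F}, forall x y, edge x y -> (x \in A) != (y \in A).

Section Induced.
Variables (G : sgraph) (S : {set G}).

Definition induced_edge : rel {x : G | x \in S} :=
  fun x y => edge (val x) (val y).

Lemma induced_edge_sym : symmetric induced_edge.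
Proof. by move=> x y; apply: edge_sym. Qed.

Lemma induced_edge_irrefl : irreflexive induced_edge.
Proof. by move=> x; apply: edge_irrefl. Qed.

Definition induced : sgraph := SGraph induced_edge_sym induced_edge_irrefl.
End Induced.

Section Complete.
Variable r : nat.

Definition complete_edge : rel 'I_r := fun i j => i != j.

Lemma complete_edge_sym : symmetric complete_edge.
Proof. by move=> i j; rewrite /complete_edge eq_sym. Qed.

Lemma complete_edge_irrefl : irreflexive complete_edge.
Proof. by move=> i; rewrite /complete_edge eqxx. Qed.

Definition complete : sgraph := SGraph complete_edge_sym complete_edge_irrefl.
End Complete.

Definition guarantees (F H : sgraph) (n m : nat) : Prop :=
  forall G : sgraph, #|G| = n -> free H G ->
    exists2 S : {set G}, #|S| = m & free F (induced S).

(* The largest m with guarantees F H n m. Searching m <= n loses nothing as soon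
   as some H-free graph on n vertices exists, e.g. for H = K_r with r >= 2 (see
   maxfree_complete). The value is 0 when no m works, which for such H
   happens only if F has no vertex. *)
Definition maxfree (F H : sgraph) (n : nat) : nat :=
  \max_(m < n.+1 | `[< guarantees F H n m >]) m.

Lemma guarantees0 (F H : sgraph) (n : nat) : (0 < #|F|)%N -> guarantees F H n 0.
Proof.
move=> /card_gt0P[x _] G _ _; exists finset.set0; first exact: cards0.
by case=> f _ _; have := valP (f x); rewrite finset.in_set0.
Qed.

Lemma guarantees_complete_le (F : sgraph) (r n m : nat) :
  (2 <= r)%N -> guarantees F (complete r) n m -> (m <= n)%N.
Proof.
move=> r2 h.
have es : symmetric (fun _ _ : 'I_n => false) by [].
have ei : irreflexive (fun _ : 'I_n => fun _ => false) by [].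
have [|[f _ fe]|S <- _] := h (SGraph es ei); first exact: card_ord.
- have r0 : (0 < r)%N by apply: leq_trans r2.
  by have := fe (Ordinal r0) (Ordinal r2) isT.
- by rewrite -[leqRHS]card_ord max_card.
Qed.

Lemma maxfree_complete (F : sgraph) (r n : nat) : (0 < #|F|)%N -> (2 <= r)%N ->
  guarantees F (complete r) n (maxfree F (complete r) n) /\
  forall m, guarantees F (complete r) n m -> (m <= maxfree F (complete r) n)%N.
Proof.
move=> F0 r2; split.
  rewrite /maxfree; apply: (big_ind (fun m => guarantees F (complete r) n m)).
  - exact: guarantees0.
  - by move=> a b ha hb; rewrite /maxn; case: ifP.
  - by move=> i /asboolP.
move=> m hm; have mn := guarantees_complete_le r2 hm.
have ltm : (m < n.+1)%N by rewrite ltnS.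
rewrite /maxfree (bigD1 (Ordinal ltm)) /=; last exact/asboolP.
exact: leq_maxl.
Qed.

Definition log2 (R : realType) (x : R) : R := ln x / ln 2.

(* Main.v *)
Require Import Defs.
From mathcomp Require Import all_boot all_order.
From mathcomp Require Import zify.

(** Give every vertex a random word in [Q^X] and a random bit for each letter,
    and join two vertices when, at some position, their letters agree and their
    bits differ. With [|X| = p], [|Q| = p^2] and [p] large:

    - A clique of size [r] is covered by complete bipartite graphs, one for each
      position and letter. By Hansel's theorem their sizes sum to at least
      [r log r], so its words repeat letters at least [c r log r] times, which
      is too unlikely to survive a union bound when the number of vertices is
      at most [p ^ (c' log r)].
    - In a set of [p^4] vertices the cells "same letter at the same position"
      have average size [p^2]. If the set contains no [K_(t,t)] then the bits
      are nearly constant on every cell, so few bit assignments are possible,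
      fewer than is needed to survive a union bound over all such sets. *)

Set Implicit Arguments.
Unset Strict Implicit.
Unset Printing Implicit Defensive.

(** * Union bound, and Hansel's theorem on biclique covers *)

(** A union bound with denominators cleared: [k] carries the factor by which each event is rare. *)
Lemma card_exists_le (Y T : finType) (P : Y -> pred T) (k B : nat) :
  (forall y, #|P y| * k <= B) ->
  #|[pred t | [exists y, P y t]]| * k <= #|Y| * B.
Proof.
move=> PB; apply: (@leq_trans ((\sum_y #|P y|) * k)).
  rewrite leq_mul2r; apply/orP; right.
  rewrite -sum1_card big_mkcond /=.
  under [leqRHS]eq_bigr => y _ do rewrite -sum1_card big_mkcond /=.
  rewrite exchange_big /=; apply: leq_sum => t _; rewrite inE.
  case: ifP => // /existsP[y Pyt].
  by rewrite (bigD1 y) //= unfold_in Pyt.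
rewrite big_distrl /= -sum_nat_const.
by apply: leq_sum => y _; apply: PB.
Qed.

(* Removing a biclique [(A, B)] from [s], the rest of [s] covers both [K :\: A]
   and [K :\: B]; adding up the two bounds so obtained gives the bound for [K]. *)
Lemma biclique_cover_weight (T : finType) (s : seq ({set T} * {set T}))
    (K : {set T}) :
  (forall p, p \in s -> [disjoint p.1 & p.2]) ->
  {in K &, forall u v, u != v -> exists2 p, p \in s &
    (u \in p.1) && (v \in p.2) || (u \in p.2) && (v \in p.1)} ->
  \sum_(v in K) 2 ^ count (fun p => v \notin p.1 :|: p.2) s <= 2 ^ size s.
Proof.
elim: s K => [|[A B] s IH] K dis cov /=.
  rewrite expn0 sum1_card; apply/card_le1_eqP => u v uK vK.
  by apply/eqP/negP => /negP uv; have [] := cov _ _ vK uK uv.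
have sub p : p \in s -> p \in (A, B) :: s by rewrite inE orbC => ->.
have step (D : {set T}) : D = A \/ D = B ->
    \sum_(v in K :\: D) 2 ^ count (fun p => v \notin p.1 :|: p.2) s <= 2 ^ size s.
  move=> DAB; apply: IH => [p /sub /dis //|u v].
  rewrite !inE => /andP[uD uK] /andP[vD vK] uv.
  have [p] := cov _ _ uK vK uv; rewrite inE => /orP[/eqP ->|ps] H; last by exists p.
  by case: DAB uD vD => -> /negbTE uD /negbTE vD; rewrite /= uD vD ?andbF in H.
have := leq_add (step A (or_introl erefl)) (step B (or_intror erefl)).
rewrite addnn -mul2n -expnS; apply: leq_trans.
rewrite [X in _ <= X + _]big_mkcond [X in _ <= _ + X]big_mkcond.
rewrite [leqLHS]big_mkcond -big_split /=; apply: leq_sum => v _.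
have /disjointFr := dis (A, B) (mem_head _ _).
rewrite !inE /= => dAB; have := dAB v.
by case: (v \in A); case: (v \in B); case: (v \in K) => //= H;
  rewrite ?addn0 ?add0n ?expnD ?expn1 ?mul2n -?addnn //; have := H isT.
Qed.

(** A vertex in fewer than [k] bicliques has weight at least [2 ^ size s / 2 ^ k.-1] in
    [biclique_cover_weight], so at most half of the vertices are such; each of the others counts at
    least [k] times. *)
Lemma biclique_cover_size (T : finType) (s : seq ({set T} * {set T})) (k : nat) :
  0 < k -> #|T| = 2 ^ k ->
  (forall p, p \in s -> [disjoint p.1 & p.2]) ->
  (forall u v, u != v -> exists2 p, p \in s &
    (u \in p.1) && (v \in p.2) || (u \in p.2) && (v \in p.1)) ->
  k * 2 ^ k.-1 <= \sum_v count (fun p => v \in p.1 :|: p.2) s.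
Proof.
case: k => // k _ cT dis cov; rewrite /=.
pose deg v := count (fun p : {set T} * {set T} => v \in p.1 :|: p.2) s.
pose low := [set v | deg v <= k].
have clow : #|low| <= 2 ^ k.
  rewrite -(@leq_pmul2r (2 ^ size s)) ?expn_gt0 //.
  rewrite -sum_nat_const.
  have w := @biclique_cover_weight T s low dis (fun u v _ _ => cov u v).
  apply: leq_trans (leq_mul (leqnn (2 ^ k)) w); rewrite big_distrr /=.
  apply: leq_sum => v; rewrite inE => dv; rewrite -expnD leq_exp2l //.
  by rewrite -(count_predC (fun p : {set T} * {set T} => v \in p.1 :|: p.2)) leq_add2r.
have chigh : 2 ^ k <= #|~: low|.
  by have := cardsC low; rewrite cT expnS; lia.
apply: (@leq_trans (\sum_(v in ~: low) deg v)); last first.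
  by rewrite [leqRHS](bigID (mem (~: low))) /= leq_addr.
apply: (@leq_trans (\sum_(v in ~: low) k.+1)).
  by rewrite sum_nat_const mulnC leq_mul2r chigh orbT.
by apply: leq_sum => v; rewrite !inE -ltnNge.
Qed.

(** * Word graphs and the repeats forced by a clique *)

Section WordGraph.
Variables (V X Q : finType) (g : {ffun V * X -> Q}) (b : {ffun V * X -> bool}).

Definition word_edge : rel V := fun u v =>
  [exists x, (g (u, x) == g (v, x)) && (b (u, x) != b (v, x))].

Lemma word_edge_sym : symmetric word_edge.
Proof.
by move=> u v; apply: eq_existsb => x; rewrite eq_sym [in X in _ && X]eq_sym.
Qed.

Lemma word_edge_irrefl : irreflexive word_edge.
Proof. by move=> u; apply/existsP => -[x]; rewrite !eqxx. Qed.

Definition word_graph : sgraph := SGraph word_edge_sym word_edge_irrefl.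

End WordGraph.

(** Requiring an earlier word, not just another one, makes the repeated letters recoverable by
    induction on the index. *)
Definition repeats (V X Q : finType) (r : nat) (f : 'I_r -> V)
    (g : {ffun V * X -> Q}) : {set 'I_r * X} :=
  [set y : 'I_r * X | [exists j : 'I_r, (j < y.1) && (g (f j, y.2) == g (f y.1, y.2))]].

(** Hansel's bound gives many shared letters. At least half of them are repeats, as each class of
    equal letters has one first word and at least one later word. *)
Lemma clique_repeats (V X Q : finType) (g : {ffun V * X -> Q})
    (b : {ffun V * X -> bool}) (k : nat) (f : 'I_(2 ^ k) -> V) :
  1 < k -> (forall i j, i != j -> word_edge g b (f i) (f j)) ->
  k * 2 ^ k.-2 <= #|repeats f g|.
Proof.
move=> k1 clq; set r := 2 ^ k in f clq *.
pose w i x := g (f i, x).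
pose shared := [set y : 'I_r * X | [exists j, (j != y.1) && (w j y.2 == w y.1 y.2)]].
(* Restricting to [shared] drops letters used by a single word, which cover no edge. *)
pose side (e : bool) (z : X * Q) :=
  [set i : 'I_r | [&& (i, z.1) \in shared, w i z.1 == z.2 & b (f i, z.1) == e]].
pose s := [seq (side false z, side true z) | z <- enum {: X * Q}].
have cs : k * 2 ^ k.-1 <= #|shared|.
  have k0 : 0 < k by lia.
  apply: leq_trans (biclique_cover_size (s := s) k0 (card_ord r) _ _) _.
  - move=> p /mapP[z _ ->] /=; rewrite disjoints_subset; apply/subsetP => i.
    by rewrite !inE => /and3P[_ _ /eqP ->]; rewrite !andbF.
  - move=> i j ij; have /existsP[x /andP[gij bij]] := clq i j ij.
    exists (side false (x, w i x), side true (x, w i x)).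
      by apply/mapP; exists (x, w i x); rewrite ?mem_enum.
    have si : (i, x) \in shared.
      by rewrite inE; apply/existsP; exists j; rewrite /= eq_sym ij /w (eqP gij) eqxx.
    have sj : (j, x) \in shared.
      by rewrite inE; apply/existsP; exists i; rewrite /= ij /w (eqP gij) eqxx.
    rewrite !inE in si sj *; rewrite si sj /= /w (eqP gij) !eqxx /=.
    by case: (b (f i, x)) (b (f j, x)) bij => [] [].
  rewrite [leqRHS](_ : _ = \sum_(i : 'I_r) #|[set x | (i, x) \in shared]|); last first.
    transitivity (\sum_(i : 'I_r) \sum_(x : X | (i, x) \in shared) 1).
      rewrite pair_big_dep /= -sum1_card; apply: eq_bigl.
      by case=> i x.
    by apply: eq_bigr => i _; rewrite -sum1_card; apply: eq_bigl => x; rewrite [RHS]inE.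
  (* A word lies in the biclique of [(x, c)] only if [c] is its letter at [x]: at most one biclique
     per shared position. *)
  apply: leq_sum => i _; rewrite /s count_map -size_filter.
  rewrite -(card_uniqP _); last by rewrite filter_uniq ?enum_uniq.
  have inj : {in [set x | (i, x) \in shared] &, injective (fun x => (x, w i x))}.
    by move=> x x' _ _ [].
  rewrite -(card_in_imset inj); apply/subset_leq_card/subsetP => -[x c].
  rewrite mem_filter /= => /andP[+ _].
  rewrite !in_setU !inE /= => H; apply/imsetP; exists x.
    by move: H; rewrite !inE; case/orP => /and3P[].
  by case/orP: H => /and3P[_ /eqP ->].
pose first := shared :\: repeats f g.
have cf : #|first| <= #|repeats f g|.
  (* A first occurrence is sent to another word with the same letter, hence into [repeats]; this is
     injective because a class has only one first word. *)
  pose nxt (y : 'I_r * X) :=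
    (odflt y.1 [pick j | (j != y.1) && (w j y.2 == w y.1 y.2)], y.2).
  have nxtP y : y \in first -> [/\ y.1 < (nxt y).1, w (nxt y).1 y.2 = w y.1 y.2 &
      forall j : 'I_r, w j y.2 = w y.1 y.2 -> y.1 <= j].
    rewrite !inE => /andP[nrep ex].
    have H j : w j y.2 = w y.1 y.2 -> y.1 <= j.
      move=> wj; rewrite leqNgt; apply/negP => lt; case/existsP: nrep; exists j.
      by rewrite lt; apply/eqP.
    rewrite /nxt; case: pickP => [j /andP[ne /eqP ew]|no] /=; last first.
      by case/existsP: ex => j; rewrite no.
    by split=> //; rewrite ltn_neqAle H // andbT eq_sym.
  have inj : {in first &, injective nxt}.
    move=> y y' /nxtP[lt ew mi] /nxtP[lt' ew' mi'] e.
    have e2 : y.2 = y'.2 by case: e.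
    rewrite -e -e2 in ew'; rewrite -e2 in mi'.
    rewrite [y]surjective_pairing [y']surjective_pairing e2; congr (_, _).
    by apply/val_inj/eqP; rewrite eqn_leq mi ?mi' // -ew -ew'.
  rewrite -(card_in_imset inj); apply/subset_leq_card/subsetP => z /imsetP[y yf ->].
  have [lt ew _] := nxtP y yf; rewrite inE; apply/existsP; exists y.1.
  by rewrite lt /=; apply/eqP.
rewrite -(@leq_pmul2l 2) // mulnCA -expnS (_ : k.-2.+1 = k.-1); last by lia.
apply: leq_trans cs _; rewrite -(cardsID (repeats f g) shared) mul2n -addnn.
by apply: leq_add cf; apply/subset_leq_card/subsetIr.
Qed.

(** * Counting letter assignments with many repeats *)

(** List [L] repeats, each with an earlier word having the same letter. There are
    [(r * #|X| * r) ^ L] candidate lists, and a list together with the remaining letters determines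
    the [L] repeated ones. *)
Lemma card_many_repeats (V X Q : finType) (r L : nat) (f : 'I_r -> V) :
  0 < #|Q| -> injective f ->
  #|[pred g : {ffun V * X -> Q} | L <= #|repeats f g|]| * #|Q| ^ L
    <= (r * #|X| * r) ^ L * #|Q| ^ (#|V| * #|X|).
Proof.
move=> /card_gt0P[q0 _] fI.
pose P (tau : L.-tuple ('I_r * X * 'I_r)) := [pred g : {ffun V * X -> Q} |
  uniq (map fst tau) &&
  all (fun t : 'I_r * X * 'I_r => (t.2 < t.1.1) && (g (f t.2, t.1.2) == g (f t.1.1, t.1.2))) tau].
apply: (@leq_trans (#|[pred g | [exists tau, P tau g]]| * #|Q| ^ L)).
  rewrite leq_mul2r; apply/orP; right; apply/subset_leq_card/subsetP => g.
  rewrite !inE => Lg.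
  pose ptr (y : 'I_r * X) : 'I_r :=
    odflt y.1 [pick j : 'I_r | (j < y.1) && (g (f j, y.2) == g (f y.1, y.2))].
  pose t := take L [seq (y, ptr y) | y <- enum (repeats f g)].
  have st : size t == L by rewrite size_takel // size_map -cardE.
  apply/existsP; exists (Tuple st); apply/andP; split => /=.
    rewrite /t map_take -map_comp map_id_in; last by [].
    by apply/take_uniq/enum_uniq.
  apply/allP => z /mem_take /mapP[y]; rewrite mem_enum inE => ex -> /=.
  rewrite /ptr; case: pickP => [//|no]; by case/existsP: ex => j; rewrite no.
rewrite -[(_ * r) ^ L](_ : #|{: L.-tuple ('I_r * X * 'I_r)}| = _); last first.
  by rewrite card_tuple !card_prod !card_ord.
apply: card_exists_le => tau.
have [u|nu] := boolP (uniq (map fst tau)); last first.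
  rewrite [#|_|](_ : _ = 0) //; apply/eqP/pred0P => g.
  by rewrite /= (negbTE nu).
pose pos (t : 'I_r * X * 'I_r) := (f t.1.1, t.1.2).
pose D := ~: [set z in map pos tau].
have cD : #|D| + L = #|V| * #|X|.
  rewrite -card_prod -(cardsC [set z in map pos tau]) addnC; congr (_ + _).
  rewrite cardsE (card_uniqP _) ?size_map ?size_tuple //.
  have -> : map pos tau = [seq (f y.1, y.2) | y <- map fst tau].
    by rewrite -map_comp.
  by rewrite map_inj_uniq // => -[i x] [j x'] [/fI -> ->].
rewrite -cD expnD leq_mul2r; apply/orP; right.
(* Erase the listed letters, with [q0] as filler. *)
pose rho (g : {ffun V * X -> Q}) := [ffun z => if z \in D then g z else q0].
have rhoI : {in P tau &, injective rho}.
  move=> g g' /andP[_ /allP Pg] /andP[_ /allP Pg'] /ffunP e.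
  have eD z : z \in D -> g z = g' z by move=> zD; have := e z; rewrite !ffunE zD.
  (* Strong induction on [i]: a listed letter equals that of its recorded earlier word. *)
  have ef (i : 'I_r) x : g (f i, x) = g' (f i, x).
    have [m] := ubnP (i : nat); elim: m i => // m IH i im.
    have [/eD //|] := boolP ((f i, x) \in D).
    rewrite !inE negbK => /mapP[[[i' x'] j] tt [/fI ii xx]].
    rewrite -{}ii -{}xx {i' x'} in tt.
    have /andP[/= ji /eqP <-] := Pg _ tt; have /andP[_ /eqP /= <-] := Pg' _ tt.
    by apply: IH; lia.
  apply/ffunP => -[v x]; have [/eD //|] := boolP ((v, x) \in D).
  rewrite !inE negbK => /mapP[[[i x'] j] _ [-> ->]]; exact: ef.
rewrite -(card_in_imset rhoI) -(card_pffun_on q0 D predT).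
apply/subset_leq_card/subsetP => _ /imsetP[g _ ->]; apply/pffun_onP; split => //.
by apply/supportP => z /negbTE zD; rewrite ffunE zD.
Qed.

(** * Bipartite subgraphs, and bits nearly constant on cells *)

Definition cell (V X Q : finType) (g : {ffun V * X -> Q})
    (b : {ffun V * X -> bool}) (S : {set V}) (e : bool) (z : X * Q) : {set V} :=
  [set v in S | (g (v, z.1) == z.2) && (b (v, z.1) == e)].

(** The two cells of one position and letter are completely joined, so each side of [F] can be sent
    injectively into its own cell. *)
Lemma contains_bipartite (F : sgraph) (V X Q : finType) (g : {ffun V * X -> Q})
    (b : {ffun V * X -> bool}) (S : {set V}) (z : X * Q) :
  bipartite F -> (forall e, #|F| <= #|cell g b S e z|) ->
  contains F (@induced (word_graph g b) S).
Proof.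
move=> [A FA] big.
pose im (u : F) : V := enum_val (widen_ord (big (u \in A)) (enum_rank u)).
have imP u : im u \in cell g b S (u \in A) z by apply: enum_valP.
have imS u : im u \in S by have := imP u; rewrite inE => /andP[].
have imI : injective im.
  move=> u v e; have eA : (u \in A) = (v \in A).
    have := imP v; rewrite -e; have := imP u.
    by rewrite !inE => /and3P[_ _ /eqP <-] /and3P[_ _ /eqP <-].
  move: e; rewrite /im; move: (big (u \in A)) (big (v \in A)); rewrite eA => B B'.
  by move=> /enum_val_inj /(congr1 val) /= /val_inj /enum_rank_inj.
exists (fun u => exist _ (im u) (imS u)) => [u v /(congr1 val) /imI //|u v uv].
apply/existsP; exists z.1; have := imP u; have := imP v; rewrite !inE /=.
move=> /and3P[_ /eqP -> /eqP ->] /and3P[_ /eqP -> /eqP ->]; rewrite eqxx /=.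
exact: FA.
Qed.

(* Such a [b] is recovered from its values outside [S], the majority value of
   each cell, and a list of the fewer than [t] exceptional vertices of each cell. *)
Lemma card_small_cells (V X Q : finType) (g : {ffun V * X -> Q}) (S : {set V})
    (t : nat) :
  #|[pred b | [forall z, [exists e, #|cell g b S e z| < t]]]| * 2 ^ (#|S| * #|X|)
    <= 2 ^ (#|V| * #|X|) * (2 ^ (#|X| * #|Q|) * #|V|.+1 ^ (#|X| * #|Q| * t)).
Proof.
pose D : {set V * X} := ~: setX S setT.
have cD : #|D| + #|S| * #|X| = #|V| * #|X|.
  by rewrite -card_prod -(cardsC (setX S [set: X])) cardsX cardsT addnC.
rewrite -cD expnD mulnAC leq_mul2r; apply/orP; right.
(* The fewer than [t] exceptions of a cell form a list padded with [None] to length [t]. *)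
pose E : finType := {ffun X * Q * 'I_t -> option V}.
pose code := setX [set b0 in pffun_on false D predT]
  (setX [set: {ffun X * Q -> bool}] [set: E]).
pose decode (w : {ffun V * X -> bool} * ({ffun X * Q -> bool} * E)) :=
  [ffun y => if y \in D then w.1 y else
     let z := (y.2, g y) in w.2.1 z (+) [exists i, w.2.2 (z, i) == Some y.1]].
have -> : 2 ^ #|D| * (2 ^ (#|X| * #|Q|) * #|V|.+1 ^ (#|X| * #|Q| * t)) = #|code|.
  rewrite !cardsX !cardsT [#|finset.finset _|]cardsE card_pffun_on !card_ffun !card_prod card_ord.
  by rewrite card_option card_bool.
apply: leq_trans (leq_imset_card decode code).
apply/subset_leq_card/subsetP => b; rewrite inE => /forallP small.
(* If the [false] cell is not small, the hypothesis makes the [true] cell small, so the cell of bit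
   [~~ sg z] is small either way. *)
pose sg : {ffun X * Q -> bool} := [ffun z => #|cell g b S false z| < t].
pose minor z := cell g b S (~~ sg z) z.
have minor_lt z : #|minor z| < t.
  rewrite /minor ffunE; case: (ltnP #|cell g b S false z| t) => //= large.
  by have /existsP[[//|]] := small z; rewrite ltnNge large.
pose ex : E := [ffun y : X * Q * 'I_t => nth None [seq Some v | v <- enum (minor y.1)] y.2].
apply/imsetP; exists ([ffun y => if y \in D then b y else false], (sg, ex)).
  rewrite !in_setX !in_setT andbT andbT inE; apply/pffun_onP; split=> //.
  by apply/supportP => y /negbTE yD; rewrite ffunE yD.
apply/ffunP => -[v x]; rewrite ffunE /=.
have [yD|] := boolP ((v, x) \in D); first by rewrite ffunE yD.
rewrite !inE negbK andbT => vS; set z := (x, g (v, x)).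
have -> : [exists i, ex (z, i) == Some v] = (v \in minor z).
  apply/existsP/idP => [[i]|vm].
    rewrite ffunE /=; case: (ltnP i (size (enum (minor z)))) => iz.
      by rewrite (nth_map v) // => /eqP[<-]; rewrite -mem_enum mem_nth.
    by rewrite nth_default ?size_map.
  have iz : index v (enum (minor z)) < #|minor z| by rewrite cardE index_mem mem_enum.
  exists (Ordinal (ltn_trans iz (minor_lt z))).
  by rewrite ffunE /= (nth_map v) -?cardE // nth_index ?mem_enum.
rewrite !inE vS /= eqxx /=; by case: (b (v, x)); case: (sg z).
Qed.

(** * Existence of the graph by two union bounds *)

(** The last two hypotheses are the union bounds. Letters are chosen first, against all maps from
    [2 ^ k] indices to vertices, then bits, against all listings of [m]-sets; this order works since
    [clique_repeats] holds for every choice of bits. *)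
Lemma exists_word_graph (n m k p q t : nat) :
  1 < k -> 0 < q ->
  n ^ 2 ^ k * (2 ^ k * p * 2 ^ k) ^ (k * 2 ^ k.-2) < q ^ (k * 2 ^ k.-2) ->
  n ^ m * (2 ^ (p * q) * n.+1 ^ (p * q * t)) < 2 ^ (m * p) ->
  exists (g : {ffun 'I_n * 'I_p -> 'I_q}) (b : {ffun 'I_n * 'I_p -> bool}),
    free (complete (2 ^ k)) (word_graph g b) /\
    forall S : {set 'I_n}, #|S| = m ->
      exists z, forall e, t <= #|cell g b S e z|.
Proof.
move=> k1 q0; set r := 2 ^ k; set L := k * _ => few_cliques few_small.
pose P (f : {ffun 'I_r -> 'I_n}) := [pred g : {ffun 'I_n * 'I_p -> 'I_q} |
  injectiveb f && (L <= #|repeats f g|)].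
have Pf f : #|P f| * q ^ L <= (r * p * r) ^ L * q ^ (n * p).
  have [/injectiveP fI|nI] := boolP (injectiveb f); last first.
    rewrite [#|_|](_ : _ = 0) //; apply/eqP/pred0P => g.
    by rewrite /= (negbTE nI).
  have := @card_many_repeats 'I_n 'I_p 'I_q r L f; rewrite !card_ord => /(_ q0 fI).
  apply: leq_trans; rewrite leq_mul2r; apply/orP; right.
  by apply/subset_leq_card/subsetP => g /andP[].
have [g gP] : exists g, ~~ [exists f, P f g].
  apply/existsP; rewrite -negb_forall; apply/negP => /forallP all_bad.
  have := card_exists_le Pf; rewrite card_ffun !card_ord.
  rewrite [#|_|](_ : _ = q ^ (n * p)); last first.
    rewrite -[RHS](_ : #|{ffun 'I_n * 'I_p -> 'I_q}| = _); last first.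
      by rewrite card_ffun card_prod !card_ord.
    by apply: eq_card => g; rewrite !inE all_bad.
  rewrite mulnA [leqRHS]mulnC leq_pmul2l ?expn_gt0 ?q0 // leqNgt.
  by rewrite few_cliques.
pose B (s : m.-tuple 'I_n) := [pred b | (#|[set v in s]| == m) &&
  [forall z, [exists e, #|cell g b [set v in s] e z| < t]]].
have Bs s : #|B s| * 2 ^ (m * p) <=
    2 ^ (n * p) * (2 ^ (p * q) * n.+1 ^ (p * q * t)).
  have [/eqP sm|nm] := boolP (#|[set v in s]| == m); last first.
    rewrite [#|_|](_ : _ = 0) //; apply/eqP/pred0P => b.
    by rewrite /= (negbTE nm).
  have := card_small_cells g [set v in s] t; rewrite !card_ord sm.
  apply: leq_trans; rewrite leq_mul2r; apply/orP; right.
  by apply/subset_leq_card/subsetP => b /andP[].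
have [b bP] : exists b, ~~ [exists s, B s b].
  apply/existsP; rewrite -negb_forall; apply/negP => /forallP all_bad.
  have := card_exists_le Bs; rewrite card_tuple !card_ord.
  rewrite [#|_|](_ : _ = 2 ^ (n * p)); last first.
    rewrite -[RHS](_ : #|{ffun 'I_n * 'I_p -> bool}| = _); last first.
      by rewrite card_ffun card_prod !card_ord card_bool.
    by apply: eq_card => b; rewrite !inE all_bad.
  by rewrite mulnCA leq_pmul2l ?expn_gt0 // leqNgt few_small.
exists g, b; split=> [[f fI fe]|S Sm].
  case/existsP: gP; exists [ffun i => f i].
  have ff : [ffun i => f i] =1 f by move=> i; rewrite ffunE.
  apply/andP; split; first by apply/injectiveP; apply: eq_inj fI _ => i; rewrite ff.
  apply: (@clique_repeats _ _ _ g b) => // i j ij; rewrite !ff; exact: fe.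
have Ss : size (enum S) == m by rewrite -cardE Sm.
have eS : [set v in Tuple Ss] = S by apply/setP => v; rewrite inE mem_enum.
have [/existsP[z zP]|no] := boolP [exists z, [forall e, t <= #|cell g b S e z|]].
  by exists z => e; apply/(forallP zP).
case/existsP: bP; exists (Tuple Ss); rewrite /= eS Sm eqxx /=.
apply/forallP => z; have := existsPn no z.
by rewrite negb_forall => /existsP[e]; rewrite -ltnNge => H; apply/existsP; exists e.
Qed.

(** * Choice of parameters and the bound on [maxfree] *)

Lemma linear_lt_expn2 (c l : nat) : c + 4 <= l -> c * l + 1 < 2 ^ l.
Proof.
move=> cl; have sq : l * l <= 2 ^ l.
  have : 4 <= l by lia.
  elim: l {cl} => // l IH; rewrite leq_eqVlt => /orP[/eqP[<-] //|l4].
  by have := IH l4; rewrite expnS; nia.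
by apply: leq_trans sq; nia.
Qed.

Lemma free_complete_leq (G : sgraph) (r s : nat) :
  r <= s -> free (complete r) G -> free (complete s) G.
Proof.
move=> rs fr [f fI fe]; apply: fr; exists (fun i => f (widen_ord rs i)).
  by move=> i j /fI /(congr1 val) /= /val_inj.
by move=> i j ij; apply: fe; rewrite /= /complete_edge -val_eqE.
Qed.

Lemma free_induced_subset (F G : sgraph) (S T : {set G}) :
  S \subset T -> free F (induced T) -> free F (induced S).
Proof.
move=> /subsetP ST fT [f fI fe]; apply: fT.
exists (fun u => exist _ (val (f u)) (ST _ (valP (f u)))) => [u v|u v /fe //].
by move=> /(congr1 val) /= /val_inj /fI.
Qed.

(** Freeness passes to subsets, so a larger [F]-free set in [G] would contain an [F]-free
    [m]-set. *)
Lemma maxfree_le (F H : sgraph) (n m : nat) (G : sgraph) :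
  #|G| = n -> free H G ->
  (forall S : {set G}, #|S| = m -> contains F (induced S)) ->
  maxfree F H n <= m.
Proof.
move=> Gn HG FS; apply/bigmax_leqP => s /boolp.asboolP gs.
rewrite leqNgt; apply/negP => ms.
have [T Ts fT] := gs G Gn HG.
have mT : m <= #|T| by rewrite Ts ltnW.
have /card_geqP[e [eu em eT]] := mT.
have Sm : #|[set v in e]| = m by rewrite cardsE (card_uniqP eu).
apply: free_induced_subset fT (FS _ Sm).
by apply/subsetP => v; rewrite inE => /eT.
Qed.

(** With [p = 2 ^ l] there are [p] positions, [p ^ 2] letters, fewer than [p ^ a] vertices, sets of
    size [p ^ 4] and cliques of size [2 ^ k = 16 ^ a.+1]. *)
Lemma maxfree_le_expn (F : sgraph) (r n a l : nat) :
  bipartite F -> 16 ^ a.+1 <= r -> n < 2 ^ (a * l) ->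
  8 * a.+1 ^ 2 < l -> a * #|F|.+1 + 4 <= l ->
  maxfree F (complete r) n <= 2 ^ (4 * l).
Proof.
move=> bF ar nl l1 l2; set t := #|F|.
pose k := 4 * a.+1.
have kr : 2 ^ k <= r by rewrite expnM.
have [||||g [b [fr FS]]] := @exists_word_graph n (2 ^ (4 * l)) k (2 ^ l) (2 ^ (2 * l)) t.
- by rewrite /k; lia.
- by rewrite expn_gt0.
- have -> : k * 2 ^ k.-2 = a.+1 * 2 ^ k.
    have -> : k = k.-2.+2 by rewrite /k; lia.
    by rewrite /= !expnS /k; lia.
  set r' := 2 ^ k.
  have r'0 : 0 < r' by rewrite expn_gt0.
  apply: (@leq_ltn_trans (2 ^ (a * l * r') * 2 ^ ((k + l + k) * (a.+1 * r')))).
    apply: leq_mul; first by rewrite [leqRHS]expnM leq_exp2r // ltnW.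
    by rewrite [leqRHS]expnM !expnD.
  (* Divided by [r'], the exponents differ by [l - 2 * k * a.+1], positive by the first lower bound
     on [l]. *)
  rewrite -expnD -expnM ltn_exp2l //.
  have -> : a * l * r' + (k + l + k) * (a.+1 * r') = (a * l + (k + l + k) * a.+1) * r' by lia.
  have -> : 2 * l * (a.+1 * r') = 2 * l * a.+1 * r' by lia.
  rewrite ltn_pmul2r //; move: l1; rewrite /k; nia.
- rewrite -!expnD.
  apply: (@leq_ltn_trans (2 ^ (a * l * 2 ^ (4 * l)) *
      (2 ^ 2 ^ (l + 2 * l) * 2 ^ (a * l * (2 ^ (l + 2 * l) * t))))).
    apply: leq_mul; first by rewrite [leqRHS]expnM leq_exp2r ?expn_gt0 // ltnW.
    apply: leq_mul => //; rewrite [leqRHS]expnM.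
    have [->|e0] := posnP (2 ^ (l + 2 * l) * t); first by rewrite !expn0.
    by rewrite leq_exp2r.
  rewrite -!expnD ltn_exp2l //.
  (* Dividing the exponents by [2 ^ (3 * l)] leaves [a * l * p + 1 + a * l * t < p ^ 2] with
     [p = 2 ^ l], which follows from [a * l * t.+1 + 1 < p]. *)
  have lin := linear_lt_expn2 l2.
  have -> : l + 2 * l = 3 * l by lia.
  have p4 : 2 ^ (4 * l) = 2 ^ (3 * l) * 2 ^ l by rewrite -expnD; congr (_ ^ _); lia.
  rewrite [ltnRHS]expnD p4.
  have : 0 < 2 ^ (3 * l) by rewrite expn_gt0.
  move: (2 ^ (3 * l)) => c c0; move: lin; rewrite -/t; move: (2 ^ l) => p lin.
  have -> : a * l * (c * p) + (c + a * l * (c * t)) = c * (a * l * p + (1 + a * l * t)) by lia.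
  rewrite -!mulnA ltn_pmul2l //.
  have p0 : 0 < p by lia.
  apply: (@leq_ltn_trans ((a * l * t.+1 + 1) * p)); last by rewrite ltn_pmul2r //; lia.
  by rewrite mulnS; nia.
apply: (@maxfree_le _ _ _ _ (word_graph g b)); first exact: card_ord.
  exact: free_complete_leq kr fr.
by move=> S /FS[z zt]; apply: contains_bipartite bF zt.
Qed.

Lemma maxfree_leq (F H : sgraph) (n : nat) : maxfree F H n <= n.
Proof. by apply/bigmax_leqP => i _; rewrite -ltnS. Qed.

(** * Passage to real exponents and the asymptotic bound *)

Unset Implicit Arguments.

From mathcomp Require Import all_boot all_order all_algebra.
From mathcomp Require Import all_classical all_reals all_analysis.
From mathcomp Require Import lra.

Import Order.TTheory GRing.Theory Num.Theory numFieldNormedType.Exports.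
Local Open Scope classical_set_scope.
Local Open Scope ring_scope.


Theorem theorem1p8 (R : realType) :
  exists2 C : R, 0 < C &
    forall (r : nat) (F : sgraph), (2 <= r)%N -> bipartite F ->
      (fun n : nat => (maxfree F (complete r) n)%:R : R)
        =O_\oo (fun n : nat => n%:R `^ (C / log2 r%:R)).
Proof.
(* [48 = 4 * 12]: for large [r] the bound has exponent [4 / a], where [log2 r <= 12 * a]. *)
exists 48 => // r F r2 bF.
have ln2 : 0 < ln (2 : R) by apply: ln_gt0; lra.
have lnr : 0 < ln (r%:R : R) by apply: ln_gt0; rewrite ltr1n.
have log2r_gt0 : 0 < log2 (r%:R : R) by apply: divr_gt0.
have log2r_le e : (r <= 2 ^ e)%N -> log2 (r%:R : R) <= e%:R.
  move=> re; rewrite ler_pdivrMr // mulr_natl -lnXn // -natrX.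
  by rewrite ler_ln ?posrE ?ltr0n ?expn_gt0 ?ler_nat // (leq_trans _ r2).
(* For [r < 256] the exponent is at least 1 and the trivial bound [n] suffices. *)
apply/eqO_exP; have [r256|r256] := ltnP r (16 ^ 2).
  exists 1 => //; near=> n; rewrite mul1r normr_nat ger0_norm ?powR_ge0 //.
  have n1 : (1 : R) <= n%:R by rewrite ler1n; near: n; exact: nbhs_infty_ge.
  apply: (@le_trans _ _ n%:R); first by rewrite ler_nat maxfree_leq.
  rewrite -[leLHS]powRr1 ?ler0n //; apply: ler_powR => //.
  rewrite ler_pdivlMr // mul1r.
  have := log2r_le 8%N (ltnW r256); lra.
(* The largest [a] with [16 ^ a.+1 <= r]; it is positive as [r >= 16 ^ 2]. *)
pose a := (trunc_log 16 r).-1.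
have ga : (1 < trunc_log 16 r)%N by apply: trunc_log_max.
have a0 : (0 < a)%N by rewrite /a; lia.
have ar : (16 ^ a.+1 <= r)%N.
  by rewrite prednK ?trunc_logP // ; lia.
(* [r < 16 ^ a.+2], and [4 * (a + 2) <= 12 * a] because [a >= 1]. *)
have log2r_a : log2 (r%:R : R) <= 12 * a%:R.
  have /log2r_le : (r <= 2 ^ (4 * a.+2))%N.
    rewrite expnM prednK; last by lia.
    by rewrite ltnW // trunc_log_ltn.
  have : (1 : R) <= a%:R by rewrite ler1n.
  rewrite natrM -addn2 natrD; lra.
(* Large enough for both lower bounds on [l] in [maxfree_le_expn]. *)
pose l0 := (8 * a.+1 ^ 2 + (a * #|F|.+1 + 4))%N.
exists 16 => //; near=> n; rewrite normr_nat ger0_norm ?powR_ge0 //.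
have n0 : (2 ^ (a * l0) <= n)%N by near: n; exact: nbhs_infty_ge.
have n1 : (0 < n)%N by apply: leq_trans n0; rewrite expn_gt0.
set T := trunc_log 2 n; pose l := (T %/ a)%N.
have l0T : (l0 <= l)%N by rewrite leq_divRL // mulnC trunc_log_max.
(* Only [n < 2 ^ (a * l.+1)] is known; using [l.+1] for [l] costs the constant [16 = 2 ^ 4]. *)
have maxl : (maxfree F (complete r) n <= 2 ^ (4 * l.+1))%N.
  apply: maxfree_le_expn bF ar _ _ _; [|by rewrite /l0 in l0T; lia..].
  apply: leq_trans (trunc_log_ltn n (isT : 1 < 2)%N) _.
  by rewrite leq_exp2l // mulnC ltn_ceil.
have la : (2 ^+ l : R) ^+ a <= n%:R.
  rewrite -exprM -natrX ler_nat; apply: leq_trans (trunc_logP (isT : 1 < 2)%N n1).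
  by rewrite leq_exp2l // leq_trunc_div.
apply: (@le_trans _ _ (16 * (2 ^+ l) ^+ 4)).
  rewrite -exprM -[16](_ : 2 ^+ 4 = _) -?exprD; last by rewrite -natrX.
  by rewrite -natrX ler_nat; apply: leq_trans maxl _; rewrite leq_exp2l //; lia.
rewrite ler_pM2l //.
apply: (@le_trans _ _ (n%:R `^ (4 / a%:R))).
  have -> : (2 ^+ l : R) ^+ 4 = ((2 ^+ l) ^+ a) `^ (4 / a%:R).
    have e0 : 0 <= 2 ^+ l :> R by rewrite exprn_ge0.
    rewrite -[LHS](powR_mulrn 4 e0) -[in RHS](powR_mulrn a e0) -powRrM mulrCA divff ?mulr1 //.
    by rewrite pnatr_eq0 -lt0n.
  by apply: ge0_ler_powR; rewrite ?nnegrE ?divr_ge0 ?exprn_ge0.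
apply: ler_powR; first by rewrite ler1n.
rewrite ler_pdivrMr ?ltr0n // mulrAC ler_pdivlMr //; lra.
Unshelve. all: by end_near.
Qed.
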